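(* Let $X\in\mathbb R^{n\times p}$, $Y\in\mathbb R^{n\times m}$, let $\Theta$ be an arbitrary threshold function, and let $$F(B,C)=\tfrac12\|Y-XB-C\|_F^2+\sum_{i=1}^nP(\|c_i\|_2;\lambda),$$ to be minimized over $(B,C)\in\mathbb R^{p\times m}\times\mathbb R^{n\times m}$ subject to $\mathrm{rank}(B)\le r$, where $c_i^T$ is the $i$th row of $C$ and $P$ is associated with $\Theta$ through $$P(t;\lambda)-P(0;\lambda)=P_\Theta(t;\lambda)+q(t;\lambda),\qquad P_\Theta(t;\lambda)=\int_0^{|t|}\big[\sup\{s:\Theta(s;\lambda)\le u\}-u\big]\,du,$$ for some nonnegative $q(\cdot;\lambda)$ with $q\{\Theta(s;\lambda);\lambda\}=0$ for all $s\in\mathbb R$. Given any $\lambda\ge0$ and $r\ge0$, let $(B^{(t)},C^{(t)})$ be generated, from a starting point $(B^{(0)},C^{(0)})$ with $\mathrm{rank}(B^{(0)})\le r$, by the iteration $$C^{(t+1)}=\vec\Theta(Y-XB^{(t)};\lambda),\qquad B^{(t+1)}=\mathcal R(X,Y-C^{(t+1)},r).$$ Then $F(B^{(t)},C^{(t)})\ge F(B^{(t+1)},C^{(t+1)})$ for all $t$, and so $F(B^{(t)},C^{(t)})$ converges as $t\to\infty$. Furthermore, under the assumptions that $\vec\Theta(\cdot;\lambda)$ is continuous in the closure of $\{Y-XB^{(t)}\}$ and $\{B^{(t)}\}$ is uniformly bounded, any accumulation point of $(B^{(t)},C^{(t)})$ is a coordinatewise minimum point, and a stationary point when $q(\cdot;\lambda)\equiv0$,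 and hence $F(B^{(t)},C^{(t)})$ converges monotonically to $F(\bar B,\bar C)$ for some coordinatewise minimum point $(\bar B,\bar C)$.
   Context: Threshold function: a real-valued function $\Theta(t;\lambda)$ defined for $-\infty<t<\infty$ and $0\le\lambda<\infty$ such that (i) $\Theta(-t;\lambda)=-\Theta(t;\lambda)$; (ii) $\Theta(t;\lambda)\le\Theta(t';\lambda)$ for $t\le t'$; (iii) $\lim_{t\to\infty}\Theta(t;\lambda)=\infty$; (iv) $0\le\Theta(t;\lambda)\le t$ for $0\le t<\infty$. Multivariate threshold function: for $a\in\mathbb R^m$, $\vec\Theta(a;\lambda)=a\,\Theta(\|a\|_2;\lambda)/\|a\|_2$ if $a\ne0$ and $\vec\Theta(0;\lambda)=0$; for a matrix, $\vec\Theta$ is applied to each row. Reduced-rank regression map: $\mathcal R(X,Y,r)=(X^TX)^-X^TY\,\mathcal P_{V(X,Y,r)}$, where $^-$ is the Moore–Penrose pseudoinverse, $V(X,Y,r)$ is formed by the leading $r$ eigenvectors of $Y^T\mathcal P_XY$, and $\mathcal P_A=A(A^TA)^-A^T$ is the orthogonal projection onto the column space of $A$. It gives a global minimizer of $\|Y-XB\|_F^2$ over $\mathrm{rank}(B)\le r$. Coordinatewise minimum point: $(\bar B,\bar C)$ with $\mathrm{rank}(\bar B)\le r$ such that $\bar B$ minimizes $F(\cdot,\bar C)$ subject to $\mathrm{rank}(B)\le r$ and $\bar C$ minimizes $F(\bar B,\cdot)$. Stationary point (when $q\equiv0$): stationarity is understood by writing $B=SV^T$ and regarding the problem as the unconstrained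 minimization of $\frac12\|Y-XSV^T-C\|_F^2+\sum_{i=1}^nP_\Theta(\|c_i\|_2;\lambda)$ over the manifold $(S,V,C)\in\mathbb R^{p\times r}\times\mathbb O^{m\times r}\times\mathbb R^{n\times m}$, $\mathbb O^{m\times r}=\{V\in\mathbb R^{m\times r}:V^TV=I\}$, with first-order optimality in each of $S$, $V$ (Riemannian gradient) and $C$ (in the generalized, subdifferential sense, as the penalty may be nonsmooth). *)

(* Defs.v *)
From HB Require Import structures.
From mathcomp Require Import all_boot all_order all_algebra.
From mathcomp Require Import all_classical all_reals all_analysis.

Set Implicit Arguments.
Unset Strict Implicit.
Unset Printing Implicit Defensive.

Import Order.TTheory GRing.Theory Num.Theory.
Import numFieldNormedType.Exports.

Local Open Scope classical_set_scope.
Local Open Scope ring_scope.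

(* The library norm `|A| on matrices is the entrywise maximum, hence the
   separate Euclidean (Frobenius) inner product and norms. *)
Definition mxdot (R : realType) (a b : nat) (A B : 'M[R]_(a, b)) : R :=
  \tr (A^T *m B).

Definition frob2 (R : realType) (a b : nat) (A : 'M[R]_(a, b)) : R :=
  \sum_i \sum_j A i j ^+ 2.

Definition l2norm (R : realType) (m : nat) (v : 'rV[R]_m) : R :=
  Num.sqrt (\sum_j v 0 j ^+ 2).

Definition is_threshold (R : realType) (Theta : R -> R -> R) : Prop :=
  forall lam : R, 0 <= lam ->
    [/\ forall t, Theta (- t) lam = - Theta t lam,
        forall t t', t <= t' -> Theta t lam <= Theta t' lam,
        Theta t lam @[t --> +oo] --> +oo
      & forall t, 0 <= t -> 0 <= Theta t lam <= t].

Definition vthresh (R : realType) (Theta : R -> R -> R) (lam : R) (m : nat)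
    (a : 'rV[R]_m) : 'rV[R]_m :=
  if a == 0 then 0 else (Theta (l2norm a) lam / l2norm a) *: a.

Definition mthresh (R : realType) (Theta : R -> R -> R) (lam : R) (n m : nat)
    (A : 'M[R]_(n, m)) : 'M[R]_(n, m) :=
  \matrix_(i < n) vthresh Theta lam (row i A).

(* For u >= 0 the set under [sup] contains 0 and is bounded above as soon as
   Theta is a threshold function, so [sup] is a genuine supremum. *)
Definition pen_of (R : realType) (Theta : R -> R -> R) (t lam : R) : R :=
  \int[lebesgue_measure]_(u in `[0, `|t|])
    (sup [set s : R | Theta s lam <= u] - u).

Definition penalty_assoc (R : realType) (Theta P q : R -> R -> R) : Prop :=
  forall lam : R, 0 <= lam ->
    [/\ forall t, 0 <= q t lam,
        forall s, q (Theta s lam) lam = 0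
      & forall t, P t lam - P 0 lam = pen_of Theta t lam + q t lam].

Definition objF (R : realType) (n p m : nat) (X : 'M[R]_(n, p))
    (Y : 'M[R]_(n, m)) (P : R -> R -> R) (lam : R)
    (B : 'M[R]_(p, m)) (C : 'M[R]_(n, m)) : R :=
  2^-1 * frob2 (Y - X *m B - C) + \sum_(i < n) P (l2norm (row i C)) lam.

Definition penrose (R : realType) (a b : nat) (A : 'M[R]_(a, b))
    (G : 'M[R]_(b, a)) : Prop :=
  [/\ A *m G *m A = A, G *m A *m G = G,
      (A *m G)^T = A *m G & (G *m A)^T = G *m A].

(* Not the library's [pinvmx], which is only a one-sided partial inverse. *)
Definition mpinv (R : realType) (a b : nat) (A : 'M[R]_(a, b)) :
    'M[R]_(b, a) :=
  xget 0 [set G | penrose A G].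

Lemma gram_unit (R : realType) (a b : nat) (A : 'M[R]_(a, b)) :
  row_free A -> A *m A^T \in unitmx.
Proof.
move=> fA; rewrite -row_free_unit -kermx_eq0; apply/eqP/row_matrixP => i.
rewrite row0; set u := row i _.
have uAA : u *m (A *m A^T) = 0 by apply/sub_kermxP; rewrite row_sub.
have sq0 : \sum_j (u *m A) 0 j ^+ 2 = 0.
  have <- : (u *m A *m (u *m A)^T) 0 0 = \sum_j (u *m A) 0 j ^+ 2.
    by rewrite mxE; apply: eq_bigr => j _; rewrite [X in _ * X]mxE expr2.
  by rewrite trmx_mul mulmxA -(mulmxA u) uAA mul0mx mxE.
have uA0 : u *m A = 0.
  apply/rowP => j; rewrite [RHS]mxE; apply/eqP; rewrite -sqrf_eq0.
  apply/eqP; move: j (isT : true).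
  by apply: psumr_eq0P sq0 => j _; rewrite sqr_ge0.
by apply: (row_free_inj fA); rewrite uA0 mul0mx.
Qed.

Lemma mpinvP (R : realType) (a b : nat) (A : 'M[R]_(a, b)) :
  penrose A (mpinv A).
Proof.
rewrite /mpinv; case: xgetP => [G _ //|].
have [k [L [W [LW fW fL]]]] : exists k (L : 'M[R]_(a, k)) (W : 'M[R]_(k, b)),
    [/\ L *m W = A, row_free W & row_free L^T].
  exists (\rank A), (col_base A), (row_base A); split; first exact: mulmx_base.
    exact: row_base_free.
  by rewrite /row_free mxrank_tr -/(row_full _) col_base_full.
have uW : W *m W^T \in unitmx by exact: gram_unit.
have uL : L^T *m L \in unitmx by rewrite -{2}(trmxK L); exact: gram_unit.
set iW := invmx (W *m W^T); set iL := invmx (L^T *m L).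
have iWt : iW^T = iW by rewrite /iW trmx_inv trmx_mul trmxK.
have iLt : iL^T = iL by rewrite /iL trmx_inv trmx_mul trmxK.
pose G := W^T *m iW *m (iL *m L^T).
have AG : A *m G = L *m (iL *m L^T).
  by rewrite -LW /G !mulmxA -(mulmxA L W) -(mulmxA L _ iW) mulmxV // mulmx1.
have GA : G *m A = W^T *m iW *m W.
  by rewrite -LW /G -!mulmxA (mulmxA L^T) (mulmxA iL) mulVmx // mul1mx.
move=> /(_ G) []; split; rewrite ?AG ?GA.
- by rewrite -LW -!mulmxA (mulmxA L^T) (mulmxA iL) mulVmx // mul1mx.
- rewrite /G -!mulmxA; congr (_ *m (_ *m _)).
  by rewrite (mulmxA W) (mulmxA _ iW) mulmxV // mul1mx.
- by rewrite !trmx_mul trmxK iLt !mulmxA.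
- by rewrite !trmx_mul trmxK iWt !mulmxA.
Qed.

Lemma penrose_uniq (R : realType) (a b : nat) (A : 'M[R]_(a, b))
    (G H : 'M[R]_(b, a)) : penrose A G -> penrose A H -> G = H.
Proof.
move=> [G1 G2 G3 G4] [H1 H2 H3 H4].
have AGH : A *m G = A *m H.
  rewrite -G3 -{1}H1 -(mulmxA (A *m H)) trmx_mul G3 H3.
  by rewrite mulmxA G1.
have GHA : G *m A = H *m A.
  rewrite -G4 -{1}H1 -(mulmxA A) mulmxA trmx_mul G4 H4.
  by rewrite -mulmxA (mulmxA A) G1.
by rewrite -G2 -mulmxA AGH mulmxA GHA H2.
Qed.

Definition proj (R : realType) (a b : nat) (A : 'M[R]_(a, b)) : 'M[R]_a :=
  A *m mpinv (A^T *m A) *m A^T.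

(* V consists of the first min(r, m) columns of an orthonormal eigenbasis of M
   sorted by nonincreasing eigenvalue. This is a relation because ties between
   eigenvalues leave the choice of V open; when r > m all m vectors are kept. *)
Definition leading_eigvecs (R : realType) (m r : nat) (M : 'M[R]_m)
    (V : 'M[R]_(m, minn r m)) : Prop :=
  exists (U : 'M[R]_m) (d : 'rV[R]_m),
    [/\ U^T *m U = 1%:M,
        M *m U = U *m diag_mx d,
        forall i j : 'I_m, (i <= j)%N -> d 0 j <= d 0 i
      & V = colsub (widen_ord (geq_minr r m)) U].

Definition rrr_map (R : realType) (n p m : nat) (X : 'M[R]_(n, p))
    (Y : 'M[R]_(n, m)) (r : nat) (B : 'M[R]_(p, m)) : Prop :=
  exists V : 'M[R]_(m, minn r m),
    leading_eigvecs (Y^T *m proj X *m Y) V /\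
    B = mpinv (X^T *m X) *m X^T *m Y *m proj V.

Definition coordwise_min (R : realType) (n p m : nat) (r : nat)
    (F : 'M[R]_(p, m) -> 'M[R]_(n, m) -> R)
    (B : 'M[R]_(p, m)) (C : 'M[R]_(n, m)) : Prop :=
  [/\ (\rank B <= r)%N,
      forall B', (\rank B' <= r)%N -> F B C <= F B' C
    & forall C', F B C <= F B C'].

Definition is_gradient (R : realType) (a b : nat) (f : 'M[R]_(a, b) -> R)
    (A G : 'M[R]_(a, b)) : Prop :=
  is_diff A f (mxdot G).

Definition stiefel (R : realType) (m k : nat) : set 'M[R]_(m, k) :=
  [set V | V^T *m V = 1%:M].

Definition stiefel_tangent (R : realType) (m k : nat) (V : 'M[R]_(m, k)) :
    set 'M[R]_(m, k) :=
  [set H | V^T *m H + H^T *m V = 0].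

(* Riemannian gradient at V of the restriction to the Stiefel manifold of a
   function f on the ambient space, for the induced Frobenius metric: the
   tangent vector representing the differential on the tangent space. *)
Definition is_stiefel_gradient (R : realType) (m k : nat)
    (f : 'M[R]_(m, k) -> R) (V G : 'M[R]_(m, k)) : Prop :=
  [/\ stiefel_tangent V G, differentiable f V
    & forall H, stiefel_tangent V H -> 'd f V H = mxdot G H].

(* Frechet subdifferential of a possibly nonconvex f; it is contained in the
   limiting and Clarke subdifferentials. *)
Definition subdifferential (R : realType) (a b : nat) (f : 'M[R]_(a, b) -> R)
    (A : 'M[R]_(a, b)) : set 'M[R]_(a, b) :=
  [set G | forall e : R, 0 < e ->
     \forall Z \near A, f A + mxdot G (Z - A) - e * `|Z - A| <= f Z].

Definition stationary_SVC (R : realType) (n p m k : nat) (X : 'M[R]_(n, p))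
    (Y : 'M[R]_(n, m)) (Theta : R -> R -> R) (lam : R)
    (S : 'M[R]_(p, k)) (V : 'M[R]_(m, k)) (C : 'M[R]_(n, m)) : Prop :=
  let f S' V' C' := objF X Y (pen_of Theta) lam (S' *m V'^T) C' in
  [/\ is_gradient (fun S' => f S' V C) S 0,
      is_stiefel_gradient (fun V' => f S V' C) V 0
    & subdifferential (fun C' => f S V C') C 0].

(* The factors have k = min(r, m) columns: there is no m x r matrix with
   orthonormal columns when r > m, and the rank constraint is then void. The
   conditions are required of every factorization of B, B being factorizable. *)
Definition stationary_point (R : realType) (n p m : nat) (X : 'M[R]_(n, p))
    (Y : 'M[R]_(n, m)) (Theta : R -> R -> R) (lam : R) (r : nat)
    (B : 'M[R]_(p, m)) (C : 'M[R]_(n, m)) : Prop :=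
  (exists (S : 'M[R]_(p, minn r m)) (V : 'M[R]_(m, minn r m)),
     stiefel V /\ B = S *m V^T) /\
  (forall (S : 'M[R]_(p, minn r m)) (V : 'M[R]_(m, minn r m)),
     stiefel V -> B = S *m V^T -> stationary_SVC X Y Theta lam S V C).

(* Main.v *)
Require Import Defs.
From mathcomp Require Import all_boot all_order all_algebra.
From mathcomp Require Import all_classical all_reals all_analysis.
From mathcomp Require Import measurable_realfun ring lra.

(* With s(u) = sup {s | Theta s <= u}, the function pen_of t + t^2 / 2 is the
   integral of the nondecreasing s over [0, t]; as y is a subgradient of it at
   Theta y, thresholding minimizes F(B, .) exactly, row by row.  The
   reduced-rank step minimizes F(., C) by Ky Fan's trace inequality.  So each
   half-step decreases F, which is bounded below.

   For a cluster point, all limits are taken along an ultrafilter U on the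
   indices that refines the one of the cluster point: along U the bounded
   sequences B(t - 1) and V(t) (orthonormal eigenvectors) converge as well.
   Continuity of the thresholding makes the limit of C(t) a thresholded matrix,
   where q vanishes, so that F passes to the limit in (B(t), C(t)) and in
   (B(t), C(t + 1)), with the same value.  Finally B = S V^T has rank at most r
   for every S and V, orthonormal or not, so a coordinatewise minimum point
   minimizes the quadratic functions of S and of V without constraint, and
   their differentials vanish. *)

Set Implicit Arguments.
Unset Strict Implicit.
Unset Printing Implicit Defensive.

Import Order.TTheory GRing.Theory Num.Theory.
Import numFieldNormedType.Exports.

Local Open Scope classical_set_scope.
Local Open Scope ring_scope.

(* [proj] alone is the projection of a product topology. *)
Local Notation proj := Defs.proj.
Local Notation mu := lebesgue_measure.

(** * The penalty *)

(** Monotonicity gives measurability, and the endpoint values bound the function on an interval of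
    finite measure. *)
Lemma nondecreasing_itv_integrable (R : realType) (s : R -> R) (x y : R)
    (b0 b1 : bool) :
  {homo s : u v / u <= v} ->
  mu.-integrable [set` Interval (BSide b0 x) (BSide b1 y)] (EFin \o s).
Proof.
move=> nds.
have mI : measurable [set` Interval (BSide b0 x) (BSide b1 y)] by [].
apply: measurable_bounded_integrable => //.
- rewrite /= lebesgue_measure_itv /=; case: ifP => // _.
  by rewrite -EFinB ltry.
- by apply: nondecreasing_measurable => // u v _ _; exact: nds.
- exists (`|s x| + `|s y|); split; first exact: num_real.
  move=> M ltM u /= uxy; apply: le_trans (ltW ltM).
  have /andP[/nds sxu /nds suy] : x <= u <= y.
    have : u \in Interval (BSide b0 x) (BSide b1 y) by [].
    rewrite itv_boundlr => /andP[].
    move: b0 b1 {mI uxy} => [] []; rewrite !bnd_simp => ? ?; apply/andP;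
    by split => //; exact: ltW.
  rewrite ler_norml; apply/andP; split.
    by apply: le_trans sxu; rewrite lerNl; apply: le_trans (ler_norm _) _;
       rewrite normrN lerDl.
  by apply: le_trans suy _; apply: le_trans (ler_norm _) _; rewrite lerDr.
Qed.

Lemma Rintegral_cst_oo (R : realType) (x y c : R) :
  x <= y -> \int[mu]_(u in `]x, y[) c = c * (y - x).
Proof.
move=> xy; rewrite Rintegral_cst //; congr (_ * _).
rewrite /= lebesgue_measure_itv /= lte_fin.
by case: ltgtP xy => // -> _; rewrite subrr.
Qed.

(** Endpoints are null, so the difference is an integral over the open interval. This matters below:
    the bound of [gen_inv_le] may fail at [u = Theta y lam]. *)
Lemma nondecreasing_RintegralB (R : realType) (s : R -> R) (x y : R) :
  {homo s : u v / u <= v} -> 0 <= x -> x <= y ->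
  \int[mu]_(u in `[0, y]) s u - \int[mu]_(u in `[0, x]) s u =
  \int[mu]_(u in `]x, y[) s u.
Proof.
move=> nds x0 xy.
rewrite Rintegral_itvB ?bnd_simp //; last exact: nondecreasing_itv_integrable.
rewrite -Rintegral_itv_bndo_bndc //; exact: nondecreasing_itv_integrable.
Qed.

Lemma Rintegral_diff_ge (R : realType) (s : R -> R) (x y c : R) :
  {homo s : u v / u <= v} -> 0 <= x -> x <= y ->
  (forall u, x < u < y -> c <= s u) ->
  c * (y - x) <= \int[mu]_(u in `[0, y]) s u - \int[mu]_(u in `[0, x]) s u.
Proof.
move=> nds x0 xy cs; rewrite nondecreasing_RintegralB // -Rintegral_cst_oo //.
apply: le_Rintegral => //.
  exact: (@nondecreasing_itv_integrable _ (cst c)).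
exact: nondecreasing_itv_integrable.
Qed.

Lemma Rintegral_diff_le (R : realType) (s : R -> R) (x y c : R) :
  {homo s : u v / u <= v} -> 0 <= x -> x <= y ->
  (forall u, x < u < y -> s u <= c) ->
  \int[mu]_(u in `[0, y]) s u - \int[mu]_(u in `[0, x]) s u <= c * (y - x).
Proof.
move=> nds x0 xy cs; rewrite nondecreasing_RintegralB // -Rintegral_cst_oo //.
apply: le_Rintegral => //.
  exact: nondecreasing_itv_integrable.
exact: (@nondecreasing_itv_integrable _ (cst c)).
Qed.

Lemma Rintegral_id (R : realType) (x : R) :
  0 <= x -> \int[mu]_(u in `[0, x]) u = x ^+ 2 / 2.
Proof.
rewrite le_eqVlt => /predU1P[<-|x0].
  by rewrite set_itv1 Rintegral_set1 expr0n mul0r.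
rewrite /Rintegral (@continuous_FTC2 _ id (fun u : R => u ^+ 2 / 2)) //=.
- by rewrite expr0n mul0r subr0.
- by apply: continuous_subspaceT => u; exact: cvg_id.
- split => //; [apply: cvg_at_right_filter|apply: cvg_at_left_filter];
  by apply: cvgM; [exact: exprn_continuous|exact: cvg_cst].
- move=> u _.
  rewrite derive1E deriveM // derive_val /= derive_val /=.
  by rewrite !scaler0 add0r /GRing.scale /= !mulr1; field.
Qed.

(** The upper generalized inverse of a threshold function; the integrand of [pen_of] is [gen_inv]
    minus the identity. *)
Definition gen_inv (R : realType) (Theta : R -> R -> R) (lam u : R) : R :=
  sup [set s | Theta s lam <= u].

Lemma threshold0 (R : realType) (Theta : R -> R -> R) (lam : R) :
  is_threshold Theta -> 0 <= lam -> Theta 0 lam = 0.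
Proof.
move=> hT /hT[_ _ _ /(_ 0 (lexx _))] /andP[? ?].
by apply/eqP; rewrite eq_le; apply/andP.
Qed.

(** Divergence at infinity bounds every such set above; oddness carries this over to minus infinity,
    which yields a member even for negative [u]. *)
Lemma gen_inv_has_sup (R : realType) (Theta : R -> R -> R) (lam u : R) :
  is_threshold Theta -> 0 <= lam -> has_sup [set s | Theta s lam <= u].
Proof.
move=> hT /hT[odd nd lim _].
have ubd (v : R) : exists M, forall s, Theta s lam <= v -> s <= M.
  have /cvgryPgt/(_ v) [M [_ HM]] := lim.
  exists (M + 1) => s; rewrite leNgt; apply: contraNle => Ms.
  by apply: HM; lra.
split.
  have [M HM] := ubd (- u).
  exists (- (M + 1)) => /=; rewrite odd.
  have : ~ (Theta (M + 1) lam <= - u) by move/HM; lra.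
  by move/negP; rewrite -ltNge => ?; lra.
by have [M HM] := ubd u; exists M => s; exact: HM.
Qed.

Lemma gen_inv_nd (R : realType) (Theta : R -> R -> R) (lam : R) :
  is_threshold Theta -> 0 <= lam -> {homo gen_inv Theta lam : u v / u <= v}.
Proof.
move=> hT l0 u v uv; apply: le_sup.
- by move=> s /= su; exists s; split => //=; exact: le_trans uv.
- by have [] := gen_inv_has_sup u hT l0.
- exact: gen_inv_has_sup.
Qed.

Lemma gen_inv_ge (R : realType) (Theta : R -> R -> R) (lam u s : R) :
  is_threshold Theta -> 0 <= lam -> Theta s lam <= u ->
  s <= gen_inv Theta lam u.
Proof.
by move=> hT l0 su; apply: (@sup_ubound _ [set s | Theta s lam <= u]) => //;
  have [] := gen_inv_has_sup u hT l0.
Qed.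

Lemma gen_inv_le (R : realType) (Theta : R -> R -> R) (lam u y : R) :
  is_threshold Theta -> 0 <= lam -> u < Theta y lam -> gen_inv Theta lam u <= y.
Proof.
move=> hT l0 uy; apply: ge_sup; first by have [] := gen_inv_has_sup u hT l0.
move=> s /= su; rewrite leNgt; apply/negP => ys.
have [_ nd _ _] := hT _ l0.
by have := nd _ _ (ltW ys); rewrite leNgt (le_lt_trans su uy).
Qed.

Lemma pen_ofE (R : realType) (Theta : R -> R -> R) (lam t : R) :
  is_threshold Theta -> 0 <= lam -> 0 <= t ->
  pen_of Theta t lam =
    \int[mu]_(u in `[0, t]) gen_inv Theta lam u - t ^+ 2 / 2.
Proof.
move=> hT l0 t0; rewrite /pen_of ger0_norm // RintegralB //.
- by rewrite Rintegral_id.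
- exact/nondecreasing_itv_integrable/gen_inv_nd.
- exact: nondecreasing_itv_integrable.
Qed.

(** By [pen_ofE] the terms [t^2 / 2] cancel and, up to a constant, the integral of [gen_inv] over
    [[0, t]] minus [y * t] remains. Its slope [gen_inv - y] is nonpositive to the left of [Theta y]
    and nonnegative to the right. *)
Lemma pen_of_scalar_min (R : realType) (Theta : R -> R -> R) (lam y t : R) :
  is_threshold Theta -> 0 <= lam -> 0 <= y -> 0 <= t ->
  2^-1 * (y - Theta y lam) ^+ 2 + pen_of Theta (Theta y lam) lam <=
  2^-1 * (y - t) ^+ 2 + pen_of Theta t lam.
Proof.
move=> hT l0 y0 t0; have [_ nd _ /(_ y y0)/andP[T0 Ty]] := hT _ l0.
rewrite !pen_ofE //; set th := Theta y lam in T0 Ty *.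
have [tht|tth] := leP th t.
  have := Rintegral_diff_ge (gen_inv_nd hT l0) T0 tht (c := y).
  suff h : forall u, th < u < t -> y <= gen_inv Theta lam u.
    by move=> /(_ h); nra.
  by move=> u /andP[/ltW thu _]; exact: gen_inv_ge.
have := Rintegral_diff_le (gen_inv_nd hT l0) t0 (ltW tth) (c := y).
suff h : forall u, t < u < th -> gen_inv Theta lam u <= y.
  by move=> /(_ h); nra.
by move=> u /andP[_ uth]; exact: gen_inv_le.
Qed.

Lemma pen_of_ge0 (R : realType) (Theta : R -> R -> R) (lam t : R) :
  is_threshold Theta -> 0 <= lam -> 0 <= pen_of Theta t lam.
Proof.
move=> hT l0; apply: Rintegral_ge0 => u /=; rewrite in_itv /= => /andP[u0 _].
have [_ _ _ /(_ u u0)/andP[_ Tu]] := hT _ l0.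
by rewrite subr_ge0; exact: gen_inv_ge.
Qed.

(** The integral of [gen_inv] is Lipschitz on [[0, M]] with constant [gen_inv Theta lam M]; the
    penalty is this integral up to [|t|], minus [t^2 / 2]. *)
Lemma pen_of_continuous (R : realType) (Theta : R -> R -> R) (lam : R) :
  is_threshold Theta -> 0 <= lam -> continuous (fun t => pen_of Theta t lam).
Proof.
move=> hT l0.
pose g t := \int[mu]_(u in `[0, t]) gen_inv Theta lam u.
have gL M x y : 0 <= x -> x <= y -> y <= M ->
    `|g y - g x| <= gen_inv Theta lam M * (y - x).
  move=> x0 xy yM; have y0 := le_trans x0 xy.
  have nd := gen_inv_nd hT l0.
  have gge0 u : 0 <= u -> 0 <= gen_inv Theta lam u.
    by move=> u0; apply: gen_inv_ge => //; rewrite threshold0.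
  rewrite ger0_norm.
    apply: Rintegral_diff_le => // u /andP[_ uy].
    by apply: nd; exact: le_trans (ltW uy) yM.
  rewrite -[0](mul0r (y - x)).
  apply: Rintegral_diff_ge => // u /andP[xu _].
  exact/gge0/(le_trans x0)/ltW.
have gL' M x y : 0 <= x -> 0 <= y -> x <= M -> y <= M ->
    `|g x - g y| <= gen_inv Theta lam M * `|x - y|.
  move=> x0 y0 xM yM; have [xy|/ltW yx] := leP x y.
    rewrite distrC [X in _ * X]distrC [X in _ * X]ger0_norm ?subr_ge0 //.
    exact: gL.
  by rewrite [X in _ * X]ger0_norm ?subr_ge0 //; exact: gL.
have -> : (fun t => pen_of Theta t lam) = (fun t => g `|t| - t ^+ 2 / 2).
  apply/funext => t; rewrite -real_normK ?num_real // -pen_ofE //.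
  by rewrite /pen_of normr_id.
move=> t; apply: cvgB; last first.
  by apply: cvgM; [exact: exprn_continuous|exact: cvg_cst].
(* A Lipschitz constant valid within distance 1 of [t]; [|K| + 1] replaces it below to have a
   positive divisor. *)
set K := gen_inv Theta lam (`|t| + 1).
apply/cvgrPdist_le => e e0; near=> x.
have dx : `|t - x| <= 1 by near: x; apply: cvgr_dist_le => //; exact: cvg_id.
have xt : `|x| <= `|t| + 1.
  by rewrite -lerBlDl; apply: le_trans dx; rewrite distrC; exact: lerB_dist.
apply: le_trans (gL' (`|t| + 1) _ _ _ _ _ _) _ => //; first by rewrite lerDl.
apply: (@le_trans _ _ ((`|K| + 1) * `|t - x|)).
  apply: ler_pM => //.
    by apply: gen_inv_ge => //; rewrite threshold0 // addr_ge0.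
    by apply: le_trans (ler_norm _) _; rewrite lerDl.
  by rewrite ler_dist_dist.
rewrite mulrC -ler_pdivlMr; last by rewrite ltr_wpDl.
near: x; apply: cvgr_dist_le; first exact: cvg_id.
by rewrite divr_gt0 // ltr_wpDl.
Unshelve. all: by end_near. Qed.

(** * Orthogonal projections and reduced-rank regression *)

Lemma frob2_ge0 (R : realType) (a b : nat) (A : 'M[R]_(a, b)) : 0 <= frob2 A.
Proof. by apply: sumr_ge0 => i _; apply: sumr_ge0 => j _; exact: sqr_ge0. Qed.

Lemma gram_diagE (R : realType) (a b : nat) (A : 'M[R]_(a, b)) (j : 'I_b) :
  (A^T *m A) j j = \sum_i A i j ^+ 2.
Proof. by rewrite mxE; apply: eq_bigr => i _; rewrite mxE expr2. Qed.

Lemma gram_diag_ge0 (R : realType) (a b : nat) (A : 'M[R]_(a, b)) (j : 'I_b) :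
  0 <= (A^T *m A) j j.
Proof. by rewrite gram_diagE; apply: sumr_ge0 => i _; exact: sqr_ge0. Qed.

Lemma frob2_tr (R : realType) (a b : nat) (A : 'M[R]_(a, b)) :
  frob2 A = \tr (A^T *m A).
Proof.
by rewrite /frob2 exchange_big; apply: eq_bigr => j _; rewrite gram_diagE.
Qed.

Lemma frob2_eq0 (R : realType) (a b : nat) (A : 'M[R]_(a, b)) :
  frob2 A = 0 -> A = 0.
Proof.
move=> A0; apply/matrixP => i j; rewrite mxE; apply/eqP; rewrite -sqrf_eq0.
have /(_ i isT) Ai0 : forall k, true -> \sum_l A k l ^+ 2 = 0.
  by apply: psumr_eq0P A0 => k _; apply: sumr_ge0 => l _; exact: sqr_ge0.
apply/eqP; move: j (isT : true); apply: psumr_eq0P Ai0 => l _.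
exact: sqr_ge0.
Qed.

Lemma frob2_pythagoras (R : realType) (a b : nat) (A B : 'M[R]_(a, b)) :
  \tr (A^T *m B) = 0 -> frob2 (A + B) = frob2 A + frob2 B.
Proof.
move=> AB.
rewrite !frob2_tr [(A + B)^T]linearD /= mulmxDl !mulmxDr !mxtraceD AB.
have -> : \tr (B^T *m A) = 0 by rewrite -mxtrace_tr trmx_mul trmxK.
by rewrite addr0 add0r.
Qed.

Lemma mpinv1 (R : realType) (k : nat) : mpinv (1%:M : 'M[R]_k) = 1%:M.
Proof.
by apply: penrose_uniq (mpinvP _) _; split; rewrite ?mul1mx ?trmx1.
Qed.

Lemma proj_orthonormal (R : realType) (a b : nat) (V : 'M[R]_(a, b)) :
  V^T *m V = 1%:M -> proj V = V *m V^T.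
Proof. by move=> VV; rewrite /proj VV mpinv1 mulmx1. Qed.

(** The transpose of the pseudoinverse satisfies the Penrose equations of the transpose of [A],
    which is [A]; uniqueness concludes. *)
Lemma mpinv_sym (R : realType) (k : nat) (A : 'M[R]_k) :
  A^T = A -> (mpinv A)^T = mpinv A.
Proof.
move=> As; apply: penrose_uniq (mpinvP A); have [G1 G2 G3 G4] := mpinvP A.
split.
- by rewrite -[X in X *m _ *m _]As -[X in _ *m _ *m X]As -!trmx_mul mulmxA G1.
- by rewrite -[X in _ *m X *m _]As -!trmx_mul mulmxA G2.
- by rewrite trmx_mul trmxK As -G4 trmx_mul As.
- by rewrite trmx_mul trmxK As -G3 trmx_mul As.
Qed.

Lemma proj_sym (R : realType) (a b : nat) (X : 'M[R]_(a, b)) :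
  (proj X)^T = proj X.
Proof.
rewrite /proj !trmx_mul trmxK mpinv_sym ?mulmxA //.
by rewrite trmx_mul trmxK.
Qed.

(** The difference [E] of the two sides is killed by [X^T], by the first Penrose equation of the
    Gram matrix, and has the form [X *m _]. Hence [E^T *m E = 0]. *)
Lemma proj_mull (R : realType) (a b : nat) (X : 'M[R]_(a, b)) :
  proj X *m X = X.
Proof.
apply/eqP; rewrite -subr_eq0; apply/eqP/frob2_eq0.
rewrite frob2_tr; set E := proj X *m X - X.
have XE : X^T *m E = 0.
  rewrite /E mulmxBr /proj !mulmxA -(mulmxA _ _ X).
  by have [-> _ _ _] := mpinvP (X^T *m X); rewrite subrr.
have -> : E = X *m (mpinv (X^T *m X) *m (X^T *m X) - 1%:M).
  by rewrite mulmxBr mulmx1 /E /proj !mulmxA.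
rewrite trmx_mul -mulmxA.
have -> : X^T *m (X *m (mpinv (X^T *m X) *m (X^T *m X) - 1%:M)) = X^T *m E.
  by rewrite mulmxBr mulmx1 /E /proj !mulmxA.
by rewrite XE mulmx0 mxtrace0.
Qed.

Lemma proj_idem (R : realType) (a b : nat) (X : 'M[R]_(a, b)) :
  proj X *m proj X = proj X.
Proof. by rewrite {2}/proj !mulmxA proj_mull. Qed.

(* W := row_base B has full row rank, so W^T (W W^T)^-1 W projects onto the
   row space of B, with trace \tr (W W^T)^-1 W W^T = \rank B. *)
Lemma row_space_projection (R : realType) (a b : nat) (B : 'M[R]_(a, b)) :
  exists Q : 'M[R]_b,
    [/\ Q^T = Q, Q *m Q = Q, B *m Q = B & \tr Q = (\rank B)%:R].
Proof.
move: (row_base B) (col_base B) (mulmx_base B) (row_base_free B) => W L LW fW.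
have uW : W *m W^T \in unitmx by exact: gram_unit.
exists (W^T *m (invmx (W *m W^T) *m W)); split.
- by rewrite !trmx_mul trmx_inv trmx_mul trmxK mulmxA.
- rewrite -[LHS]mulmxA; congr (_ *m _).
  by rewrite -!mulmxA (mulmxA W W^T) (mulKVmx uW).
- rewrite -[X in X *m _]LW -[RHS]LW -mulmxA (mulmxA W) (mulmxA (W *m W^T)).
  by rewrite (mulmxV uW) mul1mx.
- by rewrite mxtrace_mulC -mulmxA mulVmx // mxtrace1.
Qed.

(** Pythagoras for [W = (W - W Q) + W Q]. Minimizing the residual over projections [Q] thus amounts
    to maximizing a trace. *)
Lemma frob2_residual (R : realType) (a b : nat) (W : 'M[R]_(a, b))
    (Q : 'M[R]_b) :
  Q^T = Q -> Q *m Q = Q ->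
  frob2 (W - W *m Q) = frob2 W - \tr (Q *m (W^T *m W)).
Proof.
move=> Qs QQ; apply/esym/eqP; rewrite subr_eq; apply/eqP.
have <- : frob2 (W *m Q) = \tr (Q *m (W^T *m W)).
  by rewrite frob2_tr trmx_mul Qs -mulmxA mxtrace_mulC -!mulmxA QQ mulmxA
    mxtrace_mulC.
rewrite -frob2_pythagoras ?subrK // mulmxA mxtrace_mulC.
rewrite [(_ - _)^T]linearB /= trmx_mul Qs mulmxA mulmxBr mulmxA QQ subrr.
by rewrite mul0mx mxtrace0.
Qed.

(** Pythagoras again: [W - A] is the sum of [W - W Q] and [(W - A) Q], which are orthogonal. *)
Lemma frob2_residual_min (R : realType) (a b : nat) (W A : 'M[R]_(a, b))
    (Q : 'M[R]_b) :
  Q^T = Q -> Q *m Q = Q -> A *m Q = A -> frob2 (W - W *m Q) <= frob2 (W - A).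
Proof.
move=> Qs QQ AQ.
have -> : W - A = (W - W *m Q) + (W *m Q - A) by rewrite addrA subrK.
rewrite [leRHS]frob2_pythagoras ?lerDl ?frob2_ge0 //.
have -> : W *m Q - A = (W - A) *m Q by rewrite mulmxBl AQ.
rewrite mulmxA mxtrace_mulC mulmxA [(W - W *m Q)^T]linearB /= trmx_mul Qs.
by rewrite [Q *m (_ - _)]mulmxBr [Q *m (Q *m _)]mulmxA QQ subrr mul0mx mxtrace0.
Qed.

Lemma weighted_sum_le_leading (R : realType) (m r : nat) (d w : 'I_m -> R) :
  (forall i j : 'I_m, (i <= j)%N -> d j <= d i) -> (forall i, 0 <= d i) ->
  (forall i, 0 <= w i <= 1) -> \sum_i w i <= r%:R ->
  \sum_i w i * d i <= \sum_(i < minn r m) d (widen_ord (geq_minr r m) i).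
Proof.
move=> dn d0 w01 wr; rewrite -(big_ord_narrow (geq_minr r m) (F := d)).
rewrite [leRHS]big_mkcond /=.
have [rm|mr] := ltnP r m; last first.
  apply: ler_sum => i _; rewrite ltn_ord.
  by have /andP[? ?] := w01 i; rewrite ler_piMl.
(* Indices start at 0, so [tau] is the first value left out of the leading sum. Each product [(w i -
   [i < r]) * (d i - tau)] is nonpositive, whence the comparison with constant [tau]. *)
pose tau := d (Ordinal rm).
rewrite -subr_le0 -sumrB.
apply: (@le_trans _ _ (\sum_(i < m) tau * (w i - (i < r)%:R))).
  apply: ler_sum => i _; have /andP[w0 w1] := w01 i; rewrite /tau.
  case: ltnP => ir /=.
    by have := dn i (Ordinal rm) (ltnW ir); nra.
  by have := dn (Ordinal rm) i ir; nra.
rewrite -mulr_sumr sumrB; apply: mulr_ge0_le0 ; first exact: d0.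
rewrite subr_le0.
apply: le_trans wr _; rewrite -natr_sum ler_nat.
rewrite -big_mkcond /= -(big_ord_widen m (fun=> 1%N) (ltnW rm)).
by rewrite sum1_card card_ord.
Qed.

(** Ky Fan's inequality. In the eigenbasis [U] the trace is the sum of the eigenvalues weighted by
    the diagonal entries of [U^T Q U], which lie in [[0, 1]] and add up to [\tr Q]. *)
Lemma trace_leading_max (R : realType) (n m r : nat) (W : 'M[R]_(n, m))
    (V : 'M[R]_(m, minn r m)) (Q : 'M[R]_m) :
  leading_eigvecs (W^T *m W) V ->
  Q^T = Q -> Q *m Q = Q -> \tr Q <= r%:R ->
  \tr (Q *m (W^T *m W)) <= \tr (V *m V^T *m (W^T *m W)).
Proof.
move=> [U [d [UU MU dn ->]]] Qs QQ trQ; set M := W^T *m W.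
have UU' := mulmx1C UU.
have dE i : d 0 i = (U^T *m M *m U) i i.
  by rewrite -mulmxA MU mulmxA UU mul1mx mxE eqxx mulr1n.
have d0 i : 0 <= d 0 i.
  rewrite dE /M mulmxA -mulmxA -trmx_mul; exact: gram_diag_ge0.
pose w i := (U^T *m Q *m U) i i.
have w0 i : 0 <= w i.
  by rewrite /w -{1}QQ mulmxA -mulmxA -{1}Qs -trmx_mul; exact: gram_diag_ge0.
have w1 i : w i <= 1.
  rewrite -subr_ge0.
  (* As [Q] is a projection, [1 - w i] is a diagonal entry of the Gram matrix of [U - Q U]. *)
  have -> : 1 - w i = ((U - Q *m U)^T *m (U - Q *m U)) i i.
    have -> : (U - Q *m U)^T *m (U - Q *m U) = 1%:M - U^T *m Q *m U.
      rewrite [(U - _)^T]linearB /= trmx_mul Qs mulmxBr !mulmxBl UU.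
      by rewrite -!mulmxA [Q *m (Q *m U)]mulmxA QQ subrr subr0.
    by rewrite 3!mxE eqxx.
  exact: gram_diag_ge0.
have -> : \tr (Q *m M) = \sum_i w i * d 0 i.
  have -> : M = U *m diag_mx d *m U^T by rewrite -MU -mulmxA UU' mulmx1.
  rewrite mulmxA mxtrace_mulC !mulmxA; apply: eq_bigr => i _.
  by rewrite mul_mx_diag mxE.
have -> : \tr (colsub (widen_ord (geq_minr r m)) U *m
    (colsub (widen_ord (geq_minr r m)) U)^T *m M) =
    \sum_(i < minn r m) d 0 (widen_ord (geq_minr r m) i).
  rewrite -mulmxA mxtrace_mulC; apply: eq_bigr => i _.
  rewrite dE !mxE; apply: eq_bigr => j _; rewrite !mxE; congr (_ * _).
  by apply: eq_bigr => k _; rewrite !mxE.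
apply: weighted_sum_le_leading => //; first by move=> i; rewrite w0 w1.
apply: le_trans trQ; rewrite -[leLHS]/(\tr (U^T *m Q *m U)).
by rewrite -mulmxA mxtrace_mulC -mulmxA UU' mulmx1.
Qed.

Lemma leading_eigvecs_orthonormal (R : realType) (m r : nat) (M : 'M[R]_m)
    (V : 'M[R]_(m, minn r m)) : leading_eigvecs M V -> V^T *m V = 1%:M.
Proof.
move=> [U [d [UU _ _ ->]]]; apply/matrixP => i j.
have := congr1 (fun A : 'M[R]_m => A (widen_ord (geq_minr r m) i)
  (widen_ord (geq_minr r m) j)) UU.
rewrite !mxE => UUij; rewrite -[RHS]UUij; apply: eq_bigr => k _.
by rewrite !mxE.
Qed.

(** The form of the update that survives limits: [V] has bounded entries, and both equations are
    closed conditions on [B] and [V]. *)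
Lemma rrr_mapE (R : realType) (n p m : nat) (X : 'M[R]_(n, p))
    (Z : 'M[R]_(n, m)) (r : nat) (B : 'M[R]_(p, m)) :
  rrr_map X Z r B ->
  exists V : 'M[R]_(m, minn r m), V^T *m V = 1%:M /\ B = B *m V *m V^T.
Proof.
move=> [V [lV ->]]; have VV := leading_eigvecs_orthonormal lV.
exists V; split => //.
by rewrite proj_orthonormal // -!mulmxA (mulmxA V^T V) VV mul1mx.
Qed.

Lemma rank_le_factor (R : realType) (p m r : nat) (S : 'M[R]_(p, minn r m))
    (V : 'M[R]_(m, minn r m)) : (\rank (S *m V^T) <= r)%N.
Proof.
apply: leq_trans (mulmx_max_rank _ _) (geq_minl r m).
Qed.

Lemma rrr_map_rank (R : realType) (n p m : nat) (X : 'M[R]_(n, p))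
    (Z : 'M[R]_(n, m)) (r : nat) (B : 'M[R]_(p, m)) :
  rrr_map X Z r B -> (\rank B <= r)%N.
Proof. by move=> /rrr_mapE[V [_ ->]]; exact: rank_le_factor. Qed.

(** Pythagoras reduces [Z] to its projection [W] on the column space of [X], and then
    [X B = W V V^T]. A competitor does no better than [W Q], with [Q] the projection on its row
    space, of trace at most [r]; Ky Fan compares [Q] with [V V^T]. *)
Lemma rrr_map_min (R : realType) (n p m : nat) (X : 'M[R]_(n, p))
    (Z : 'M[R]_(n, m)) (r : nat) (B B' : 'M[R]_(p, m)) :
  rrr_map X Z r B -> (\rank B' <= r)%N ->
  frob2 (Z - X *m B) <= frob2 (Z - X *m B').
Proof.
move=> [V [lV ->]] rB'; have VV := leading_eigvecs_orthonormal lV.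
rewrite proj_orthonormal //; set W := proj X *m Z.
have split_res (A : 'M[R]_(p, m)) :
    frob2 (Z - X *m A) = frob2 (Z - W) + frob2 (W - X *m A).
  have -> : Z - X *m A = (Z - W) + (W - X *m A) by rewrite addrA subrK.
  apply: frob2_pythagoras.
  have -> : W - X *m A = proj X *m (W - X *m A).
    by rewrite mulmxBr (mulmxA _ X A) proj_mull /W mulmxA proj_idem.
  rewrite mulmxA [(Z - W)^T]linearB /= /W trmx_mul proj_sym mulmxBl.
  by rewrite -(mulmxA Z^T) proj_idem subrr mul0mx mxtrace0.
rewrite !split_res lerD2l.
have -> : X *m (mpinv (X^T *m X) *m X^T *m Z *m (V *m V^T)) = W *m (V *m V^T).
  by rewrite /W /Defs.proj !mulmxA.
have [Q [Qs QQ BQ trQ]] := row_space_projection B'.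
apply: (@le_trans _ _ (frob2 (W - W *m Q))); last first.
  by apply: frob2_residual_min => //; rewrite -mulmxA BQ.
have VVs : (V *m V^T)^T = V *m V^T by rewrite trmx_mul trmxK.
have VVi : V *m V^T *m (V *m V^T) = V *m V^T.
  by rewrite mulmxA -(mulmxA V) VV mulmx1.
rewrite !frob2_residual // lerD2l lerN2.
(* The matrix whose eigenvectors define [V] is the Gram matrix of [W], as [trace_leading_max]
   requires. *)
have WE : Z^T *m proj X *m Z = W^T *m W.
  rewrite /W trmx_mul proj_sym -[RHS]mulmxA (mulmxA (proj X) (proj X)).
  by rewrite proj_idem mulmxA.
rewrite WE in lV.
by apply: (trace_leading_max lV) => //; rewrite trQ ler_nat.
Qed.

(** * Row norms and exact minimization in each block *)

Lemma l2norm_ge0 (R : realType) (m : nat) (v : 'rV[R]_m) : 0 <= l2norm v.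
Proof. exact: sqrtr_ge0. Qed.

Lemma sqr_l2norm (R : realType) (m : nat) (v : 'rV[R]_m) :
  l2norm v ^+ 2 = \sum_j v 0 j ^+ 2.
Proof. by rewrite sqr_sqrtr //; apply: sumr_ge0 => j _; exact: sqr_ge0. Qed.

Lemma l2normZ (R : realType) (m : nat) (k : R) (v : 'rV[R]_m) :
  l2norm (k *: v) = `|k| * l2norm v.
Proof.
rewrite /l2norm -sqrtr_sqr -sqrtrM ?sqr_ge0 //; congr Num.sqrt.
by rewrite mulr_sumr; apply: eq_bigr => j _; rewrite mxE exprMn.
Qed.

Lemma l2norm0 (R : realType) (m : nat) : l2norm (0 : 'rV[R]_m) = 0.
Proof. by rewrite -(scale0r 0) l2normZ normr0 mul0r. Qed.

Lemma l2norm_eq0 (R : realType) (m : nat) (v : 'rV[R]_m) :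
  (l2norm v == 0) = (v == 0).
Proof.
apply/idP/eqP => [/eqP v0|->]; last by rewrite l2norm0.
have : \sum_j v 0 j ^+ 2 = 0 by rewrite -sqr_l2norm v0 expr0n.
move=> /psumr_eq0P h; apply/rowP => j; rewrite mxE; apply/eqP.
by rewrite -sqrf_eq0 h // => k _; exact: sqr_ge0.
Qed.

Lemma frob2_rows (R : realType) (n m : nat) (A : 'M[R]_(n, m)) :
  frob2 A = \sum_i l2norm (row i A) ^+ 2.
Proof.
apply: eq_bigr => i _; rewrite sqr_l2norm.
by apply: eq_bigr => j _; rewrite mxE.
Qed.

Lemma l2norm_sub_ge (R : realType) (m : nat) (a c : 'rV[R]_m) :
  (l2norm a - l2norm c) ^+ 2 <= l2norm (a - c) ^+ 2.
Proof.
have [->|a0] := eqVneq a 0.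
  by rewrite l2norm0 !sub0r sqrrN -scaleN1r l2normZ normrN1 mul1r.
have [->|c0] := eqVneq c 0; first by rewrite l2norm0 !subr0.
have na : 0 < l2norm a by rewrite lt_neqAle l2norm_ge0 eq_sym l2norm_eq0 a0.
have nc : 0 < l2norm c by rewrite lt_neqAle l2norm_ge0 eq_sym l2norm_eq0 c0.
(* One expansion used twice: coefficients [1, 1] give the norm of [a - c], while
   [l2norm c, l2norm a] give Cauchy-Schwarz from the nonnegativity of a sum of squares. *)
have Eac (s t : R) : \sum_j (s * a 0 j - t * c 0 j) ^+ 2 =
    s ^+ 2 * l2norm a ^+ 2 + t ^+ 2 * l2norm c ^+ 2
    - 2 * s * t * \sum_j a 0 j * c 0 j.
  rewrite !sqr_l2norm !mulr_sumr -big_split -sumrB /=.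
  by apply: eq_bigr => j _; ring.
have -> : l2norm (a - c) ^+ 2 = l2norm a ^+ 2 + l2norm c ^+ 2
    - 2 * \sum_j a 0 j * c 0 j.
  have := Eac 1 1; rewrite !expr1n !mul1r !mulr1 => <-.
  by rewrite sqr_l2norm; apply: eq_bigr => j _; rewrite !mxE !mul1r.
have := Eac (l2norm c) (l2norm a).
set z := \sum_j a 0 j * c 0 j => E.
have : 0 <= \sum_j (l2norm c * a 0 j - l2norm a * c 0 j) ^+ 2.
  by apply: sumr_ge0 => j _; exact: sqr_ge0.
rewrite {}E => h; suff : z <= l2norm a * l2norm c by nra.
have nac : 0 < l2norm a * l2norm c by rewrite mulr_gt0.
rewrite -(ler_pM2l nac); nra.
Qed.

Lemma l2norm_vthresh (R : realType) (Theta : R -> R -> R) (lam : R) (m : nat)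
    (a : 'rV[R]_m) :
  is_threshold Theta -> 0 <= lam ->
  l2norm (vthresh Theta lam a) = Theta (l2norm a) lam.
Proof.
move=> hT l0; rewrite /vthresh; case: eqVneq => [->|a0].
  by rewrite l2norm0 threshold0.
have na : l2norm a != 0 by rewrite l2norm_eq0.
have [_ _ _ /(_ _ (l2norm_ge0 a))/andP[T0 _]] := hT _ l0.
by rewrite l2normZ ger0_norm ?divr_ge0 ?l2norm_ge0 // divfK.
Qed.

Lemma l2norm_sub_vthresh (R : realType) (Theta : R -> R -> R) (lam : R)
    (m : nat) (a : 'rV[R]_m) :
  is_threshold Theta -> 0 <= lam ->
  l2norm (a - vthresh Theta lam a) = l2norm a - Theta (l2norm a) lam.
Proof.
move=> hT l0; have [->|a0] := eqVneq a 0.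
  by rewrite /vthresh eqxx subr0 l2norm0 (threshold0 hT l0) subr0.
rewrite /vthresh (negPf a0).
have na : l2norm a != 0 by rewrite l2norm_eq0.
have [_ _ _ /(_ _ (l2norm_ge0 a))/andP[T0 Ta]] := hT _ l0.
rewrite -{1}(scale1r a) -scalerBl l2normZ ger0_norm; first by field.
by rewrite subr_ge0 ler_pdivrMr ?mul1r // lt_neqAle l2norm_ge0 eq_sym na.
Qed.

(** The reverse triangle inequality, an equality at the thresholded vector, reduces the problem to
    norms, where [pen_of_scalar_min] applies. The term [q] is nonnegative and vanishes at values of
    [Theta]. *)
Lemma vthresh_min (R : realType) (Theta P q : R -> R -> R) (lam : R) (m : nat)
    (a c : 'rV[R]_m) :
  is_threshold Theta -> penalty_assoc Theta P q -> 0 <= lam ->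
  2^-1 * l2norm (a - vthresh Theta lam a) ^+ 2
    + P (l2norm (vthresh Theta lam a)) lam <=
  2^-1 * l2norm (a - c) ^+ 2 + P (l2norm c) lam.
Proof.
move=> hT hPq l0; have [q0 qT PE] := hPq _ l0.
rewrite l2norm_vthresh // l2norm_sub_vthresh //.
have := PE (Theta (l2norm a) lam); rewrite qT => PT.
have Pc := PE (l2norm c).
have := pen_of_scalar_min hT l0 (l2norm_ge0 a) (l2norm_ge0 c).
have := l2norm_sub_ge a c; have := q0 (l2norm c); lra.
Qed.

Lemma objF_rows (R : realType) (n p m : nat) (X : 'M[R]_(n, p))
    (Y : 'M[R]_(n, m)) (P : R -> R -> R) (lam : R) (B : 'M[R]_(p, m))
    (C : 'M[R]_(n, m)) :
  objF X Y P lam B C =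
  \sum_i (2^-1 * l2norm (row i (Y - X *m B) - row i C) ^+ 2
            + P (l2norm (row i C)) lam).
Proof.
rewrite /objF frob2_rows mulr_sumr -big_split /=.
by apply: eq_bigr => i _; rewrite linearB.
Qed.

Lemma objF_mthresh_min (R : realType) (n p m : nat) (X : 'M[R]_(n, p))
    (Y : 'M[R]_(n, m)) (Theta P q : R -> R -> R) (lam : R) (B : 'M[R]_(p, m))
    (C : 'M[R]_(n, m)) :
  is_threshold Theta -> penalty_assoc Theta P q -> 0 <= lam ->
  objF X Y P lam B (mthresh Theta lam (Y - X *m B)) <= objF X Y P lam B C.
Proof.
move=> hT hPq l0; rewrite !objF_rows; apply: ler_sum => i _.
by rewrite /mthresh rowK; exact: vthresh_min hPq l0.
Qed.

Lemma objF_rrr_min (R : realType) (n p m : nat) (X : 'M[R]_(n, p))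
    (Y : 'M[R]_(n, m)) (P : R -> R -> R) (lam : R) (r : nat)
    (B B' : 'M[R]_(p, m)) (C : 'M[R]_(n, m)) :
  rrr_map X (Y - C) r B -> (\rank B' <= r)%N ->
  objF X Y P lam B C <= objF X Y P lam B' C.
Proof.
move=> hB rB'; rewrite lerD2r ler_pM2l ?invr_gt0 ?ltr0n //.
by rewrite ![Y - _ - C]addrAC; exact: (rrr_map_min hB rB').
Qed.

(** * Stationarity *)

Lemma mx_entry_le_norm (R : realType) (a b : nat) (A : 'M[R]_(a, b)) i j :
  `|A i j| <= `|A|.
Proof.
rewrite [leRHS]/Num.norm /= mx_normrE.
by apply/bigmax_geP; right; exists (i, j).
Qed.

Lemma frob2_le_norm (R : realType) (a b : nat) (A : 'M[R]_(a, b)) :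
  frob2 A <= (a * b)%:R * `|A| ^+ 2.
Proof.
apply: (@le_trans _ _ (\sum_(i < a) \sum_(j < b) `|A| ^+ 2)).
  apply: ler_sum => i _; apply: ler_sum => j _.
  by rewrite -real_normK ?num_real // ler_sqr ?nnegrE ?mx_entry_le_norm.
by rewrite !sumr_const !card_ord -mulrnA mulr_natl mulnC.
Qed.

Lemma linear_mx_bounded (R : realType) (a b n m : nat)
    (L : {linear 'M[R]_(a, b) -> 'M[R]_(n, m)}) :
  exists2 K : R, 0 <= K & forall H, `|L H| <= K * `|H|.
Proof.
exists (\sum_i \sum_j `|L (delta_mx i j)|).
  by apply: sumr_ge0 => i _; apply: sumr_ge0.
move=> H; rewrite {1}(matrix_sum_delta H) linear_sum mulr_suml.
apply: le_trans (ler_norm_sum _ _ _) _; apply: ler_sum => i _.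
rewrite linear_sum mulr_suml.
apply: le_trans (ler_norm_sum _ _ _) _; apply: ler_sum => j _.
by rewrite linearZ normrZ mulrC ler_wpM2l ?mx_entry_le_norm.
Qed.

Lemma frob2_sub (R : realType) (a b : nat) (A B : 'M[R]_(a, b)) :
  frob2 (A - B) = frob2 A - 2 * mxdot A B + frob2 B.
Proof.
rewrite /mxdot !frob2_tr [(A - B)^T]linearB /= mulmxBl !mulmxBr !linearB /=.
have -> : \tr (B^T *m A) = \tr (A^T *m B) by rewrite -mxtrace_tr trmx_mul trmxK.
by ring.
Qed.

Lemma frob2Z (R : realType) (a b : nat) (t : R) (A : 'M[R]_(a, b)) :
  frob2 (t *: A) = t ^+ 2 * frob2 A.
Proof.
rewrite /frob2 mulr_sumr; apply: eq_bigr => i _; rewrite mulr_sumr.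
by apply: eq_bigr => j _; rewrite mxE exprMn.
Qed.

(** The expansion of [f] at [Z0] is exact: a linear term, which minimality forces to vanish, and a
    quadratic term, which is negligible. *)
Lemma least_squares_min_is_diff (R : realType) (a b n m : nat)
    (L : {linear 'M[R]_(a, b) -> 'M[R]_(n, m)}) (A : 'M[R]_(n, m)) (c : R)
    (f : 'M[R]_(a, b) -> R) (Z0 : 'M[R]_(a, b)) :
  (forall Z, f Z = 2^-1 * frob2 (A - L Z) + c) -> (forall Z, f Z0 <= f Z) ->
  is_diff Z0 f 0.
Proof.
move=> fE fmin; set E := A - L Z0.
have fD H : f (H + Z0) = f Z0 - mxdot E (L H) + 2^-1 * frob2 (L H).
  rewrite !fE linearD /= opprD addrCA addrC -/E frob2_sub.
  by rewrite !mulrDr mulrN mulrA mulVf ?pnatr_eq0 // mul1r; ring.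
have E0 H : mxdot E (L H) = 0.
  have dotZ t : mxdot E (L (t *: H)) = t * mxdot E (L H).
    by rewrite /mxdot linearZ /= -scalemxAr mxtraceZ.
  set s := mxdot E (L H) in dotZ *; set Q := frob2 (L H).
  have Q0 : 0 <= Q by exact: frob2_ge0.
  (* For [t = s / (Q + 1)] the change of [f] is [- t * s + t^2 * Q / 2 = - t^2 * (1 + Q / 2)], so
     minimality forces [t = 0]. The added 1 covers [Q = 0]. *)
  have := fmin ((s / (Q + 1)) *: H + Z0).
  rewrite fD dotZ [L _]linearZ /= frob2Z -/Q => h.
  have Qp : 0 < Q + 1 by rewrite ltr_wpDl.
  have tE : (s / (Q + 1)) * (Q + 1) = s by rewrite divfK // gt_eqF.
  move: h tE; set t := s / (Q + 1) => h tE.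
  suff : t = 0 by move=> t0; rewrite -tE t0 mul0r.
  apply/eqP; rewrite -sqrf_eq0 eq_le sqr_ge0 andbT.
  by rewrite -tE in h; nra.
have [K K0 LK] := linear_mx_bounded L.
have dfE : f \o shift Z0 = cst (f Z0) + 0 +o_ (0 : 'M[R]_(a, b)) id.
  apply/eqaddoP => e e0.
  (* [M * |H|^2] bounds the quadratic term: [K] bounds [L], and [n * m] compares the Frobenius norm
     with the entrywise maximum. *)
  pose M := 2^-1 * ((n * m)%:R * K ^+ 2).
  have M0 : 0 <= M by rewrite !mulr_ge0 ?invr_ge0 ?sqr_ge0.
  near=> H; rewrite /= addr0 !fctE /= fD E0 subr0 addrC addKr.
  rewrite ger0_norm ?mulr_ge0 ?invr_ge0 ?frob2_ge0 //.
  apply: (@le_trans _ _ (M * `|H| * `|H|)).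
    have hL : `|L H| ^+ 2 <= K ^+ 2 * `|H| ^+ 2.
      by rewrite -exprMn ler_sqr ?nnegrE ?mulr_ge0.
    have := ler_wpM2l (ler0n R (n * m)) hL.
    have := frob2_le_norm (L H); rewrite /M; lra.
  apply: ler_wpM2r => //.
  apply: (@le_trans _ _ ((M + 1) * `|H|)); first by rewrite ler_wpM2r // lerDl.
  rewrite mulrC -ler_pdivlMr ?ltr_wpDl //.
  near: H; apply: (@nbhs0_le _ 'M[R]_(a, b)); rewrite divr_gt0 // ltr_wpDl //.
have c0 : continuous ((fun=> 0) : 'M[R]_(a, b) -> R) by exact: cst_continuous.
have d0 : 'd f Z0 = 0 :> ('M[R]_(a, b) -> R) by exact: diff_unique.
by split => //; apply/diff_locallyP; rewrite d0.
Unshelve. all: by end_near. Qed.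

Lemma mxdot0 (R : realType) (a b : nat) :
  mxdot (0 : 'M[R]_(a, b)) = 0 :> ('M[R]_(a, b) -> R).
Proof. by apply/funext => H; rewrite /mxdot trmx0 mul0mx mxtrace0. Qed.

Lemma coordwise_min_stationary (R : realType) (n p m : nat) (X : 'M[R]_(n, p))
    (Y : 'M[R]_(n, m)) (Theta : R -> R -> R) (lam : R) (r : nat)
    (S : 'M[R]_(p, minn r m)) (V : 'M[R]_(m, minn r m)) (C : 'M[R]_(n, m)) :
  coordwise_min r (objF X Y (pen_of Theta) lam) (S *m V^T) C ->
  stationary_SVC X Y Theta lam S V C.
Proof.
move=> [_ minB minC].
have objE B : objF X Y (pen_of Theta) lam B C = 2^-1 * frob2 (Y - C - X *m B) +
    \sum_(i < n) pen_of Theta (l2norm (row i C)) lam.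
  by rewrite /objF [Y - _ - C]addrAC.
split.
- rewrite /is_gradient mxdot0.
  apply: (@least_squares_min_is_diff _ _ _ _ _
    (mulmx X \o mulmxr V^T : {linear _ -> _})) => Z; first exact: objE.
  by apply: minB; exact: rank_le_factor.
(* The whole ambient differential vanishes, so the Riemannian gradient is the tangent vector 0. *)
- have dV : is_diff V
      (fun V' => objF X Y (pen_of Theta) lam (S *m V'^T) C) 0.
    apply: (@least_squares_min_is_diff _ _ _ _ _
      (mulmx X \o mulmx S \o trmx : {linear _ -> _})) => Z; first exact: objE.
    by apply: minB; exact: rank_le_factor.
  split => //.
    by rewrite /stiefel_tangent /= mulmx0 trmx0 mul0mx addr0.
  by move=> H _; rewrite mxdot0 diff_val.
- move=> e e0; apply: (@nearW _ _ _ (nbhs_filter C)) => Z; rewrite mxdot0 addr0.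
  by apply: le_trans (minC Z); rewrite gerBl mulr_ge0 // ltW.
Qed.

(** * Limits along ultrafilters *)

Lemma ultra_fmap (T T' : Type) (f : T -> T') (U : set_system T) :
  UltraFilter U -> UltraFilter (f @ U).
Proof.
move=> UU; split; first exact: fmap_proper_filter.
move=> G GF sUG; apply/seteqP; split; last exact: sUG.
move=> A GA; have [//|UnA] := in_ultra_setVsetC (f @^-1` A) UU.
have GnA : G (~` A) by exact: sUG.
by have /filter_ex [? []] : G (A `&` ~` A) by exact: filterI.
Qed.

Lemma cvg_mx (R : realType) (T : Type) (U : set_system T) (a b : nat)
    (u : T -> 'M[R]_(a, b)) (l : 'M[R]_(a, b)) :
  Filter U -> (forall i j, u t i j @[t --> U] --> l i j) -> u @ U --> l.
Proof.
move=> FU ul A [P lP PA].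
have : \forall t \near U, forall ij, P ij.1 ij.2 (u t ij.1 ij.2).
  by apply: filter_forall => -[i j]; exact/ul/lP.
by apply: filterS => t Pt; apply: PA => i j; exact: (Pt (i, j)).
Qed.

Lemma cvg_mx_entry (R : realType) (T : Type) (U : set_system T) (a b : nat)
    (u : T -> 'M[R]_(a, b)) (l : 'M[R]_(a, b)) i j :
  Filter U -> u @ U --> l -> u t i j @[t --> U] --> l i j.
Proof.
move=> FU ul.
apply: (@continuous_cvg _ _ _ U FU u (fun A => A i j) l) => //.
exact: coord_continuous.
Qed.

(** Bolzano-Weierstrass without subsequences: each entry stays in a compact segment, where every
    ultrafilter converges. *)
Lemma ultra_bounded_mx_cvg (R : realType) (T : Type) (U : set_system T)
    (a b : nat) (u : T -> 'M[R]_(a, b)) (M : R) :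
  UltraFilter U -> (\forall t \near U, forall i j, `|u t i j| <= M) ->
  exists l : 'M[R]_(a, b), u @ U --> l.
Proof.
move=> UU uM.
have ex i j : exists l : R, u t i j @[t --> U] --> l.
  have := @segment_compact R (- M) M; rewrite compact_ultra.
  move=> /(_ (u t i j @[t --> U]) (ultra_fmap _ UU)) [|l [_ ul]]; last first.
    by exists l.
  apply: filterS uM => t /(_ i j); rewrite ler_norml => /andP[? ?].
  by rewrite /= in_itv /=; apply/andP.
(* By [ex] a limit exists for every entry, so the default 0 is never taken. *)
pose l := \matrix_(i, j) xget 0 [set x : R | u t i j @[t --> U] --> x].
exists l; apply: cvg_mx => i j; rewrite mxE.
by case: xgetP => [x _ //|] /(_ _) nex; have [x /nex] := ex i j.
Qed.

Lemma cvg_mulmx (R : realType) (T : Type) (U : set_system T) (a b c : nat)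
    (u : T -> 'M[R]_(a, b)) (v : T -> 'M[R]_(b, c))
    (l : 'M[R]_(a, b)) (k : 'M[R]_(b, c)) :
  Filter U -> u @ U --> l -> v @ U --> k -> u t *m v t @[t --> U] --> l *m k.
Proof.
move=> FU ul vk; apply: cvg_mx => i j; rewrite mxE; under eq_cvg do rewrite mxE.
apply: cvg_big => [|s _]; first exact: add_continuous.
by apply: cvgM; exact: cvg_mx_entry.
Qed.

Lemma cvg_trmx (R : realType) (T : Type) (U : set_system T) (a b : nat)
    (u : T -> 'M[R]_(a, b)) (l : 'M[R]_(a, b)) :
  Filter U -> u @ U --> l -> (u t)^T @[t --> U] --> l^T.
Proof.
move=> FU ul; apply: cvg_mx => i j; rewrite mxE; under eq_cvg do rewrite mxE.
exact: cvg_mx_entry.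
Qed.

Lemma cvg_sqr_sum (R : realType) (T : Type) (U : set_system T) (n : nat)
    (f : 'I_n -> T -> R) (l : 'I_n -> R) :
  Filter U -> (forall i, f i @ U --> l i) ->
  \sum_i f i t ^+ 2 @[t --> U] --> \sum_i l i ^+ 2.
Proof.
move=> FU fl; apply: cvg_big => [|i _]; first exact: add_continuous.
by rewrite expr2; under eq_cvg do rewrite expr2; apply: cvgM.
Qed.

Lemma cvg_frob2 (R : realType) (T : Type) (U : set_system T) (a b : nat)
    (u : T -> 'M[R]_(a, b)) (l : 'M[R]_(a, b)) :
  Filter U -> u @ U --> l -> frob2 (u t) @[t --> U] --> frob2 l.
Proof.
move=> FU ul; apply: cvg_big => [|i _]; first exact: add_continuous.
by apply: cvg_sqr_sum => j; exact: cvg_mx_entry.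
Qed.

Lemma cvg_l2norm_row (R : realType) (T : Type) (U : set_system T) (a b : nat)
    (u : T -> 'M[R]_(a, b)) (l : 'M[R]_(a, b)) i :
  Filter U -> u @ U --> l ->
  l2norm (row i (u t)) @[t --> U] --> l2norm (row i l).
Proof.
move=> FU ul.
apply: (@continuous_cvg _ _ _ U FU (fun t => \sum_j row i (u t) 0 j ^+ 2)
  Num.sqrt (\sum_j row i l 0 j ^+ 2)); first exact: sqrt_continuous.
apply: cvg_sqr_sum => j; rewrite mxE; under eq_cvg do rewrite mxE.
exact: cvg_mx_entry.
Qed.

(** Stated for [pen_of], which is continuous; a general [P] also contains [q], which may be
    discontinuous. *)
Lemma cvg_objF_pen_of (R : realType) (T : Type) (U : set_system T) (n p m : nat)
    (X : 'M[R]_(n, p)) (Y : 'M[R]_(n, m)) (Theta : R -> R -> R) (lam : R)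
    (B : T -> 'M[R]_(p, m)) (C : T -> 'M[R]_(n, m))
    (Bb : 'M[R]_(p, m)) (Cb : 'M[R]_(n, m)) :
  is_threshold Theta -> 0 <= lam -> Filter U -> B @ U --> Bb -> C @ U --> Cb ->
  objF X Y (pen_of Theta) lam (B t) (C t) @[t --> U] -->
    objF X Y (pen_of Theta) lam Bb Cb.
Proof.
move=> hT l0 FU BB CC; apply: cvgD.
  apply: cvgM; first exact: cvg_cst.
  apply: cvg_frob2; apply: cvgB => //; apply: cvgB; first exact: cvg_cst.
  by apply: cvg_mulmx => //; exact: cvg_cst.
apply: cvg_big => [|i _]; first exact: add_continuous.
apply: (@continuous_cvg _ _ _ U FU (fun t => l2norm (row i (C t)))
  (fun s => pen_of Theta s lam)); first exact: pen_of_continuous.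
exact: cvg_l2norm_row.
Qed.

(** The row norms of a thresholded matrix are values of [Theta], where [q] vanishes; on such
    matrices [P] may be traded for the continuous [pen_of]. *)
Lemma objF_pen_of_mthresh (R : realType) (n p m : nat) (X : 'M[R]_(n, p))
    (Y : 'M[R]_(n, m)) (Theta P q : R -> R -> R) (lam : R) (B : 'M[R]_(p, m))
    (A : 'M[R]_(n, m)) :
  is_threshold Theta -> penalty_assoc Theta P q -> 0 <= lam ->
  objF X Y P lam B (mthresh Theta lam A) =
  objF X Y (pen_of Theta) lam B (mthresh Theta lam A) + P 0 lam *+ n.
Proof.
move=> hT hPq l0; have [_ qT PE] := hPq _ l0.
rewrite /objF -[RHS]addrA; congr (_ + _).
have -> : P 0 lam *+ n = \sum_(i < n) P 0 lam by rewrite sumr_const card_ord.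
rewrite -big_split /=.
apply: eq_bigr => i _; rewrite rowK l2norm_vthresh //.
by have := PE (Theta (l2norm (row i A)) lam); rewrite qT; lra.
Qed.

Lemma objF_pen_of_q0 (R : realType) (n p m : nat) (X : 'M[R]_(n, p))
    (Y : 'M[R]_(n, m)) (Theta P q : R -> R -> R) (lam : R) (B : 'M[R]_(p, m))
    (C : 'M[R]_(n, m)) :
  penalty_assoc Theta P q -> 0 <= lam -> (forall t, q t lam = 0) ->
  objF X Y P lam B C = objF X Y (pen_of Theta) lam B C + P 0 lam *+ n.
Proof.
move=> hPq l0 q0; have [_ _ PE] := hPq _ l0.
rewrite /objF -[RHS]addrA; congr (_ + _).
have -> : P 0 lam *+ n = \sum_(i < n) P 0 lam by rewrite sumr_const card_ord.
rewrite -big_split /=.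
by apply: eq_bigr => i _; have := PE (l2norm (row i C)); rewrite q0; lra.
Qed.

Lemma objF_ge (R : realType) (n p m : nat) (X : 'M[R]_(n, p))
    (Y : 'M[R]_(n, m)) (Theta P q : R -> R -> R) (lam : R) (B : 'M[R]_(p, m))
    (C : 'M[R]_(n, m)) :
  is_threshold Theta -> penalty_assoc Theta P q -> 0 <= lam ->
  P 0 lam *+ n <= objF X Y P lam B C.
Proof.
move=> hT hPq l0; have [q0 _ PE] := hPq _ l0.
apply: (@le_trans _ _ (\sum_(i < n) P (l2norm (row i C)) lam)).
  have -> : P 0 lam *+ n = \sum_(i < n) P 0 lam by rewrite sumr_const card_ord.
  apply: ler_sum => i _.
  have := PE (l2norm (row i C)); have := q0 (l2norm (row i C)).
  by have := pen_of_ge0 (l2norm (row i C)) hT l0; lra.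
by rewrite lerDr mulr_ge0 ?invr_ge0 ?frob2_ge0.
Qed.

Lemma orthonormal_entry_le1 (R : realType) (a b : nat) (V : 'M[R]_(a, b)) i j :
  V^T *m V = 1%:M -> `|V i j| <= 1.
Proof.
move=> VV; rewrite -[leRHS]normr1 -ler_sqr ?nnegrE // !real_normK ?num_real //.
have := gram_diagE V j; rewrite VV mxE eqxx expr1n mulr1n => ->.
by rewrite (bigD1 i) //= lerDl; apply: sumr_ge0 => k _; exact: sqr_ge0.
Qed.

(** The chosen [V] have entries bounded by 1, hence converge along [U], and both equations pass to
    the limit; [S] is then [Bb *m V]. This gives the rank bound at the limit as well as a
    factorization. *)
Lemma ultra_limit_factor (R : realType) (T : Type) (U : set_system T)
    (p m k : nat) (B : T -> 'M[R]_(p, m)) (Bb : 'M[R]_(p, m)) :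
  UltraFilter U -> B @ U --> Bb ->
  (\forall t \near U, exists V : 'M[R]_(m, k),
     V^T *m V = 1%:M /\ B t = B t *m V *m V^T) ->
  exists (S : 'M[R]_(p, k)) (V : 'M[R]_(m, k)), stiefel V /\ Bb = S *m V^T.
Proof.
move=> UU BB exV.
pose Q t (V : 'M[R]_(m, k)) := V^T *m V = 1%:M /\ B t = B t *m V *m V^T.
pose Vt t := xget 0 (Q t).
have VtP : \forall t \near U, Q t (Vt t).
  by apply: filterS exV => t ex; rewrite /Vt; apply: xgetPex.
have [|V VV] := @ultra_bounded_mx_cvg _ _ U _ _ Vt 1 UU.
  by apply: filterS VtP => t [h _] i j; exact: orthonormal_entry_le1.
exists (Bb *m V), V; split.
  have h1 : (Vt t)^T *m Vt t @[t --> U] --> V^T *m V.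
    by apply: cvg_mulmx => //; exact: cvg_trmx.
  have h2 : (Vt t)^T *m Vt t @[t --> U] --> (1%:M : 'M[R]_k).
    by apply: cvg_near_cst; apply: filterS VtP => t [].
  exact: (cvg_unique (@norm_hausdorff _ _) h1 h2).
have h1 : B t *m Vt t *m (Vt t)^T @[t --> U] --> Bb *m V *m V^T.
  by apply: cvg_mulmx; [exact: cvg_mulmx|exact: cvg_trmx].
have h2 : B t *m Vt t *m (Vt t)^T @[t --> U] --> Bb.
  apply: cvg_trans BB; apply: near_eq_cvg.
  by apply: filterS VtP => t [_ <-].
exact: (cvg_unique (@norm_hausdorff _ _) h2 h1).
Qed.

Lemma bounded_range_entry (R : realType) (T : Type) (a b : nat)
    (u : T -> 'M[R]_(a, b)) :
  bounded_set (range u) -> exists M : R, forall t i j, `|u t i j| <= M.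
Proof.
move=> [M [_ hM]]; exists (M + 1) => t i j.
apply: le_trans (mx_entry_le_norm _ _ _) _.
by apply: hM; [rewrite ltrDl|exists t].
Qed.

Lemma within_closure_cvg (T : Type) (S S' : topologicalType) (U : set_system T)
    (g : T -> S) (f : S -> S') (D : set S) (x : S) :
  ProperFilter U -> {within closure D, continuous f} ->
  (\forall t \near U, D (g t)) -> g @ U --> x -> f (g t) @[t --> U] --> f x.
Proof.
move=> FU /subspace_continuousP cf gD gx.
have Dx : closure D x.
  move=> W Wx; have : \forall t \near U, (D `&` W) (g t).
    by apply: filterI => //; exact: (gx W Wx).
  by move=> /filter_ex [t ?]; exists (g t).
move=> W /(cf _ Dx) W'.
have : \forall t \near U, closure D (g t) -> W (f (g t)) by exact: (gx _ W').
by apply: filterS2 gD => t /(@subset_closure _ D) Dg /(_ Dg).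
Qed.

Lemma ultra_limit_coordwise_min (R : realType) (n p m : nat)
    (X : 'M[R]_(n, p)) (Y : 'M[R]_(n, m)) (Theta P q : R -> R -> R) (lam : R)
    (r : nat) (B : nat -> 'M[R]_(p, m)) (C : nat -> 'M[R]_(n, m)) (Finf : R)
    (U : set_system nat) (Bb : 'M[R]_(p, m)) (Cb : 'M[R]_(n, m)) :
  is_threshold Theta -> penalty_assoc Theta P q -> 0 <= lam ->
  (forall t, C t.+1 = mthresh Theta lam (Y - X *m B t)) ->
  (forall t, rrr_map X (Y - C t.+1) r (B t.+1)) ->
  {within closure (range (fun t => Y - X *m B t)),
     continuous (@mthresh R Theta lam n m)} ->
  bounded_set (range B) ->
  objF X Y P lam (B t) (C t) @[t --> \oo] --> Finf ->
  UltraFilter U -> \oo `<=` U -> B @ U --> Bb -> C @ U --> Cb ->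
  [/\ coordwise_min r (objF X Y P lam) Bb Cb, objF X Y P lam Bb Cb = Finf
    & exists (S : 'M[R]_(p, minn r m)) (V : 'M[R]_(m, minn r m)),
        stiefel V /\ Bb = S *m V^T].
Proof.
move=> hT hPq l0 hC hB hcont bB FF UU oU BB CC.
have Upos : \forall t \near U, (0 < t)%N by apply: oU; exact: nbhs_infty_gt.
have fact : exists (S : 'M[R]_(p, minn r m)) (V : 'M[R]_(m, minn r m)),
    stiefel V /\ Bb = S *m V^T.
  apply: ultra_limit_factor BB _.
  by apply: filterS Upos => -[//|t] _; exact: rrr_mapE (hB t).
have resid (B' : nat -> 'M[R]_(p, m)) Bl : B' @ U --> Bl ->
    Y - X *m B' t @[t --> U] --> Y - X *m Bl.
  by move=> h; apply: cvgB; [|apply: cvg_mulmx => //]; exact: cvg_cst.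
have [M hM] := bounded_range_entry bB.
(* [C t] is computed from [B t.-1], hence the limit of the shifted sequence; the value at [t = 0] is
   immaterial, [U] containing the positive indices. *)
have [|Bp BpP] := @ultra_bounded_mx_cvg _ _ U _ _ (B \o predn) M UU.
  by apply: filterE => t i j; exact: hM.
have CbE : Cb = mthresh Theta lam (Y - X *m Bp).
  have h : mthresh Theta lam (Y - X *m (B \o predn) t) @[t --> U] -->
      mthresh Theta lam (Y - X *m Bp).
    apply: within_closure_cvg hcont _ (resid _ _ BpP).
    by apply: filterE => t; exists t.-1.
  apply: (cvg_unique (@norm_hausdorff _ _) CC _).
  apply: cvg_trans h; apply: near_eq_cvg.
  by apply: filterS Upos => -[//|t] _; rewrite hC.
have CE : \forall t \near U, exists A, C t = mthresh Theta lam A.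
  by apply: filterS Upos => -[//|t] _; exists (Y - X *m B t).
(* The limit of [C t.+1], obtained from [Bb] itself, whereas [Cb] is obtained from [Bp]; the two are
   compared only through the value of [F]. *)
pose Db := mthresh Theta lam (Y - X *m Bb).
have DD : C t.+1 @[t --> U] --> Db.
  under eq_cvg do rewrite hC.
  apply: within_closure_cvg hcont _ (resid _ _ BB).
  by apply: filterE => t; exists t.
(* [F] passes to the limit as long as the second argument and its limit are thresholded matrices. *)
have limF (Bs : nat -> 'M[R]_(p, m)) Bl (Cs : nat -> 'M[R]_(n, m)) Cl :
    Bs @ U --> Bl -> Cs @ U --> Cl ->
    (\forall t \near U, exists A, Cs t = mthresh Theta lam A) ->
    (exists A, Cl = mthresh Theta lam A) ->
    objF X Y P lam (Bs t) (Cs t) @[t --> U] --> objF X Y P lam Bl Cl.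
  move=> hBs hCs CsE [A ClE].
  have -> : objF X Y P lam Bl Cl =
      objF X Y (pen_of Theta) lam Bl Cl + P 0 lam *+ n.
    by rewrite ClE (objF_pen_of_mthresh _ _ _ _ hT hPq l0).
  apply: (@cvg_trans _
    (objF X Y (pen_of Theta) lam (Bs t) (Cs t) + P 0 lam *+ n @[t --> U])).
    apply: near_eq_cvg; apply: filterS CsE => t [A' ->].
    by rewrite (objF_pen_of_mthresh _ _ _ _ hT hPq l0).
  by apply: cvgD; [exact: cvg_objF_pen_of|exact: cvg_cst].
have FU : objF X Y P lam (B t) (C t) @[t --> U] --> Finf.
  exact: cvg_trans (cvg_app _ oU) FF.
have FbE : objF X Y P lam Bb Cb = Finf.
  apply: (cvg_unique (@norm_hausdorff _ _) _ FU).
  by apply: limF => //; exists (Y - X *m Bp).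
have FdE : objF X Y P lam Bb Db = Finf.
  have FUS : objF X Y P lam (B t.+1) (C t.+1) @[t --> U] --> Finf.
    apply: cvg_trans (cvg_app _ oU) _.
    by rewrite (cvg_shiftS (fun t => objF X Y P lam (B t) (C t))).
  (* The value after the half-step in [C] lies between two consecutive values of [F], which have the
     same limit. *)
  have h : objF X Y P lam (B t) (C t.+1) @[t --> U] --> Finf.
    apply: squeeze_cvgr FUS FU; near=> t; apply/andP; split.
      apply: objF_rrr_min; first exact: hB.
      have : (0 < t)%N by near: t.
      by case: (t) => // t' _; exact: rrr_map_rank (hB t').
    by rewrite hC; exact: objF_mthresh_min hT hPq l0.
  apply: (cvg_unique (@norm_hausdorff _ _) _ h).
  apply: limF => //; last by exists (Y - X *m Bb).
  by apply: filterE => t; exists (Y - X *m B t).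
split=> //; split.
- by have [S [V [_ ->]]] := fact; exact: rank_le_factor.
- move=> B' rB'; rewrite FbE.
  (* Each [B t] with [t > 0] beats the fixed competitor [B'] at [C t]; the inequality passes to the
     limit. *)
  have h : objF X Y P lam B' (C t) @[t --> U] --> objF X Y P lam B' Cb.
    by apply: limF => //; [exact: cvg_cst|exists (Y - X *m Bp)].
  apply: (ler_cvg_to FU h); apply: filterS Upos => -[//|t] _.
  by apply: objF_rrr_min rB'; exact: hB.
(* [Db] minimizes [F Bb] exactly and [Cb] attains the same value [Finf]. *)
- by move=> C'; rewrite FbE -FdE; exact: objF_mthresh_min hT hPq l0.
Unshelve. all: by end_near. Qed.

(** * Accumulation points and convergence of the iteration *)

Lemma cluster_fmap_ultra (T : Type) (S : topologicalType) (F : set_system T)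
    (u : T -> S) (x : S) :
  ProperFilter F -> cluster (u @ F) x ->
  exists U : set_system T, [/\ UltraFilter U, F `<=` U & u @ U --> x].
Proof.
move=> FF clx.
(* These traces are nonempty because [x] is a cluster point. Any ultrafilter above [G] contains [F]
   and makes [u] converge to [x]. *)
pose G := filter_from [set AW : set T * set S | F AW.1 /\ nbhs x AW.2]
  (fun AW => AW.1 `&` u @^-1` AW.2).
have GF : ProperFilter G.
  apply: filter_from_proper.
    apply: filter_from_filter.
      by exists (setT, setT); split; exact: filterT.
    move=> [A W] [A' W'] [/= FA xW] [/= FA' xW'].
    exists (A `&` A', W `&` W'); first by split; exact: filterI.
    by move=> t [[? ?] [? ?]].
  move=> [A W] [/= FA xW].
  have FuA : F (u @^-1` (u @` A)) by apply: filterS FA => t At; exists t.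
  have [_ [[t At <-] Wt]] := clx _ _ FuA xW.
  by exists t.
have [U [UU GU]] := ultraFilterLemma GF.
exists U; split => //.
  move=> A FA; apply: GU; exists (A, setT) => [|t []//].
  by split => //; exact: filterT.
move=> W xW; apply: GU; exists (setT, W) => [|t []//].
by split => //; exact: filterT.
Qed.

Theorem theorem7 (R : realType) (n p m : nat)
    (X : 'M[R]_(n, p)) (Y : 'M[R]_(n, m))
    (Theta : R -> R -> R) (hTheta : is_threshold Theta)
    (P q : R -> R -> R) (hPq : penalty_assoc Theta P q)
    (lam : R) (hlam : 0 <= lam) (r : nat)
    (B : nat -> 'M[R]_(p, m)) (C : nat -> 'M[R]_(n, m))
    (hB0 : (\rank (B 0%N) <= r)%N)
    (hC : forall t : nat, C t.+1 = mthresh Theta lam (Y - X *m B t))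
    (hB : forall t : nat, rrr_map X (Y - C t.+1) r (B t.+1)) :
  let F := objF X Y P lam in
  [/\ forall t : nat, F (B t.+1) (C t.+1) <= F (B t) (C t),
      cvgn (fun t : nat => F (B t) (C t))
    & {within closure (range (fun t : nat => Y - X *m B t)),
         continuous (@mthresh R Theta lam n m)} ->
      bounded_set (range B) ->
      (forall (Bb : 'M[R]_(p, m)) (Cb : 'M[R]_(n, m)),
         cluster ((fun t : nat => (B t, C t)) @ \oo) (Bb, Cb) ->
         coordwise_min r F Bb Cb /\
         ((forall t : R, q t lam = 0) ->
            stationary_point X Y Theta lam r Bb Cb)) /\
      (exists (Bb : 'M[R]_(p, m)) (Cb : 'M[R]_(n, m)),
         [/\ coordwise_min r F Bb Cb,
             nonincreasing_seq (fun t : nat => F (B t) (C t))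
           & (fun t : nat => F (B t) (C t)) @ \oo --> F Bb Cb])].
Proof.
move=> F.
have rB t : (\rank (B t) <= r)%N.
  by case: t => [//|t]; exact: rrr_map_rank (hB t).
have Fdec t : F (B t.+1) (C t.+1) <= F (B t) (C t).
  apply: (@le_trans _ _ (F (B t) (C t.+1))); first exact: objF_rrr_min (hB t) _.
  by rewrite hC; exact: objF_mthresh_min hTheta hPq hlam.
have Fni : nonincreasing_seq (fun t => F (B t) (C t)).
  exact/nonincreasing_seqP.
have Fcvg : cvgn (fun t => F (B t) (C t)).
  apply: nonincreasing_is_cvgn => //; exists (P 0 lam *+ n) => _ [t _ <-].
  exact: objF_ge hTheta hPq hlam.
split=> // hcont bB; split=> [Bb Cb clBC|].
  have [U [UU oU BCU]] := cluster_fmap_ultra eventually_filter clBC.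
  have BB : B @ U --> Bb  by exact: (cvg_comp _ _ BCU cvg_fst).
  have CC : C @ U --> Cb  by exact: (cvg_comp _ _ BCU cvg_snd).
  have [minBC _ fact] := ultra_limit_coordwise_min hTheta hPq hlam hC hB hcont
    bB Fcvg UU oU BB CC.
  (* With [q = 0] the objectives for [P] and for [pen_of] differ by a constant, so minimality
     carries over to the latter. *)
  split=> // q0; split=> // S V _ BbE; apply: coordwise_min_stationary.
  rewrite -BbE; case: minBC => rBb minB minC; split=> //.
  - move=> B' /minB; rewrite /F !(objF_pen_of_q0 _ _ _ _ hPq hlam q0).
    by rewrite lerD2r.
  - move=> C'; have := minC C'.
    by rewrite /F !(objF_pen_of_q0 _ _ _ _ hPq hlam q0) lerD2r.
have [U0 [UU0 oU0]] := ultraFilterLemma (@eventually_filter).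
have [M hM] := bounded_range_entry bB.
have [|Bp BpP] := @ultra_bounded_mx_cvg _ _ U0 _ _ B M UU0.
  by apply: filterE => t i j; exact: hM.
(* Only [B] is assumed bounded. Shifting the ultrafilter by one index turns convergence of [B] along
   [U0] into convergence of [C] along [U]; [B] converges along [U] by boundedness. *)
pose U := S @ U0; have UU : UltraFilter U := ultra_fmap S UU0.
have oU : \oo `<=` U.
  move=> A [N _ NA]; apply: oU0; exists N => // t /= Nt; apply: NA => /=.
  exact: leqW.
have [|Bb BB] := @ultra_bounded_mx_cvg _ _ U _ _ B M UU.
  by apply: filterE => t i j; exact: hM.
have CC : C @ U --> mthresh Theta lam (Y - X *m Bp).
  have CS : C \o S = (fun t => mthresh Theta lam (Y - X *m B t)).
    by apply/funext => t; rewrite /= hC.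
  rewrite /U -fmap_comp CS; apply: within_closure_cvg hcont _ _.
    by apply: filterE => t; exists t.
  by apply: cvgB; [|apply: cvg_mulmx => //]; exact: cvg_cst.
have [minBC FE _] := ultra_limit_coordwise_min hTheta hPq hlam hC hB hcont bB
  Fcvg UU oU BB CC.
by exists Bb, (mthresh Theta lam (Y - X *m Bp)); rewrite /F FE.
Qed.
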